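(* Let $1\leq\alpha\leq2$ and let $f(z)=z+\sum_{n=2}^{\infty}a_{n}z^{n}$ be analytic in the open unit disc $\mathbb{U}=\{z\in\mathbb{C}:|z|<1\}$ and satisfy \[ \operatorname{Re}\left\{\frac{zf'(z)}{f(z)}\right\}>\frac{\alpha}{2}-1\qquad (z\in\mathbb{U}). \] Then \[ \left|a_{2}a_{4}-a_{3}^{2}\right|\leq\frac{(2-\frac{\alpha}{2})^{2}}{3}\left[4\left((2-\tfrac{\alpha}{2})^{2}-1\right)+3\right]. \]
   Context: The class of such $f$ is denoted $S_{\alpha}^{\ast}$ in the paper (starlike functions of order $\frac{\alpha}{2}-1$). The quantity $a_2a_4-a_3^2$ is the second Hankel determinant of $f$. *)

(* Defs.v *)
From Stdlib Require Import Reals.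
From Coquelicot Require Export Coquelicot.
Open Scope R_scope.

(* Main.v *)
(** Put b = 2 - alpha/2, N = (z f' - f) / z^2 and D = (z f' - f + 2 b f) / z. The
    condition on Re (z f' / f) says |z N| < |D|, so by the Schwarz lemma phi = N / D maps
    the disc into its closure. With phi = t0 + t1 z + t2 z^2 + ..., comparing coefficients
    gives
      a2 a4 - a3^2 = b^2/3 (4 t0 t2 + 2 t0^2 t1 - 3 t1^2 + (1 - 4 b^2) t0^4),
    and two steps of Schur's algorithm give |t1| <= 1 - |t0|^2 and
    |t2 (1 - |t0|^2) + conj t0 t1^2| <= (1 - |t0|^2)^2 - |t1|^2; the bound follows from the
    triangle inequality. The degenerate case |t0| = 1 is reached by replacing phi by r phi
    and letting r tend to 1. *)

Require Import Defs.
From Stdlib Require Import Reals Lra ClassicalEpsilon.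
From Coquelicot Require Import Coquelicot.
Open Scope R_scope.

(** * Power series on the unit disc *)

(** With q = z f'/f - 1 the hypothesis reads Re q > -b, that is, q lies nearer to 0 than to -2b.
    Hence |q / (q + 2b)| < 1, and this quotient is z N / D. The Schwarz lemma needs the maximum
    modulus principle, which is derived here from power series alone, without integrals: a quotient
    of convergent power series has a second-order expansion with cubic error wherever the
    denominator is nonzero, and averaging such an expansion over four points excludes an interior
    maximum of |F| + eps |z|^2. The constant 4 b^2 - 1 is the modulus of the form in t0, t1, t2 at
    |t0| = 1, t1 = t2 = 0. The condition alpha <= 2 gives b >= 1, and this makes that boundary case
    the extreme one: after the triangle inequality the slack is at least (4 b^2 - 4)(1 - |t0|^4). *)

Lemma ex_series_Rmult_l (c : R) (u : nat -> R) :
  ex_series u -> ex_series (fun n => c * u n).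
Proof. exact (ex_series_scal (K := R_AbsRing) (V := R_NormedModule) c u). Qed.

Lemma is_pseries_Cpow (a : nat -> C) (z l : C) :
  is_pseries a z l <-> is_series (fun n => a n * z ^ n)%C l.
Proof.
  split; intros H; (eapply is_series_ext; [|exact H]); intros n;
    [change (z ^ n * a n = a n * z ^ n)%C | change (a n * z ^ n = z ^ n * a n)%C];
    apply Cmult_comm.
Qed.

(** A term is the difference of two consecutive partial sums, and a convergent sequence of partial
    sums is bounded. *)
Lemma is_series_terms_bounded (u : nat -> C) (l : C) :
  is_series u l -> exists M, forall n, Cmod (u n) <= M.
Proof.
  intros H.
  destruct (filterlim_bounded (sum_n u) (ex_intro _ l H)) as [M HM].
  exists (M + M); intros [|n].
  - specialize (HM O). rewrite sum_O in HM. change (Cmod (u O) <= M) in HM.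
    pose proof (Cmod_ge_0 (u O)). lra.
  - pose proof (HM n) as H1. pose proof (HM (S n)) as H2.
    rewrite sum_Sn in H2.
    change (Cmod (sum_n u n) <= M) in H1.
    change (Cmod (sum_n u n + u (S n))%C <= M) in H2.
    replace (u (S n)) with ((sum_n u n + u (S n)) + - sum_n u n)%C by ring.
    eapply Rle_trans; [apply Cmod_triangle|]. rewrite Cmod_opp. lra.
Qed.

Lemma is_series_Cmod_le (u : nat -> C) (v : nat -> R) (l : C) :
  is_series u l -> (forall n, Cmod (u n) <= v n) -> ex_series v ->
  Cmod l <= Series v.
Proof.
  intros Hu Huv Hv.
  apply (is_lim_seq_le (fun n => Cmod (sum_n u n)) (sum_n v) (Cmod l) (Series v)).
  - intros n. induction n as [|n IH].
    + rewrite !sum_O. apply Huv.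
    + rewrite !sum_Sn. eapply Rle_trans; [apply Cmod_triangle|].
      apply Rplus_le_compat; auto.
  - apply (filterlim_comp _ _ _ (sum_n u) Cmod eventually (locally l)); [exact Hu|].
    exact (filterlim_norm (K := C_AbsRing) (V := C_NormedModule) l).
  - exact (Series_correct v Hv).
Qed.

Definition pseries_on_disc (a : nat -> C) (F : C -> C) : Prop :=
  forall z : C, Cmod z < 1 -> is_pseries a z (F z).

(** Abel's comparison: convergence at a radius s between r and 1 bounds the terms there by some [M],
    so at radius r they are dominated by the geometric series of ratio r / s. *)
Lemma pseries_on_disc_abs (a : nat -> C) (F : C -> C) (r : R) :
  pseries_on_disc a F -> 0 < r < 1 -> ex_series (fun n => Cmod (a n) * r ^ n).
Proof.
  intros HF Hr. set (s := (1 + r) / 2).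
  assert (Hs : r < s < 1) by (unfold s; lra).
  assert (Hm : Cmod s = s) by (rewrite Cmod_R; apply Rabs_pos_eq; lra).
  destruct (is_series_terms_bounded _ _
    (proj1 (is_pseries_Cpow _ _ _) (HF (RtoC s) ltac:(rewrite Hm; lra)))) as [M HM].
  assert (Hq : Rabs (r / s) < 1).
  { rewrite Rabs_pos_eq by (apply Rlt_le, Rdiv_lt_0_compat; lra).
    apply (Rmult_lt_reg_r s); [lra|]. field_simplify; lra. }
  apply (ex_series_le (K := R_AbsRing) (V := R_CompleteNormedModule) _
           (fun n => M * (r / s) ^ n)).
  - intros n. specialize (HM n). rewrite Cmod_mult, Cmod_pow, Hm in HM.
    change (Rabs (Cmod (a n) * r ^ n) <= M * (r / s) ^ n).
    rewrite Rabs_pos_eq by (apply Rmult_le_pos; [apply Cmod_ge_0|apply pow_le; lra]).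
    replace (Cmod (a n) * r ^ n) with (Cmod (a n) * s ^ n * (r / s) ^ n).
    + apply Rmult_le_compat_r; [apply pow_le, Rlt_le, Rdiv_lt_0_compat; lra|exact HM].
    + rewrite Rmult_assoc, <- Rpow_mult_distr. do 2 f_equal. field. lra.
  - apply (ex_series_Rmult_l M). eexists. apply is_series_geom, Hq.
Qed.

(** * Second-order Taylor expansion of monomials and of power series *)

Fixpoint pow_d1 (z : C) (n : nat) : C :=
  match n with O => 0%C | S m => (z * pow_d1 z m + z ^ m)%C end.

(** [pow_d1 z n] is n z^(n-1) and [pow_d2 z n] is n(n-1)/2 z^(n-2), half the second derivative. The
    recursions expand the product z * z^m; they avoid truncated exponents and let the bounds below
    go by induction. *)
Fixpoint pow_d2 (z : C) (n : nat) : C :=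
  match n with O => 0%C | S m => (z * pow_d2 z m + pow_d1 z m)%C end.

Lemma pow_d1_S (z : C) (n : nat) : pow_d1 z (S n) = (INR (S n) * z ^ n)%C.
Proof.
  induction n as [|n IH].
  - simpl. ring.
  - change (pow_d1 z (S (S n))) with (z * pow_d1 z (S n) + z ^ S n)%C.
    rewrite IH, (S_INR (S n)), RtoC_plus. simpl Cpow. ring.
Qed.

(* Dominating n z^(n-1) etc. by r^n for a slightly larger radius r is Cauchy's estimate in disguise. *)
Lemma pow_d1_bound (z : C) (rho r : R) (n : nat) :
  Cmod z <= rho -> rho < r -> Cmod (pow_d1 z n) <= r ^ n / (r - rho).
Proof.
  intros Hz Hr. pose proof (Cmod_ge_0 z) as H0.
  induction n as [|n IH]; simpl pow_d1; simpl pow.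
  - rewrite Cmod_0. apply Rlt_le, Rdiv_lt_0_compat; lra.
  - eapply Rle_trans; [apply Cmod_triangle|].
    rewrite Cmod_mult, Cmod_pow.
    assert (Cmod z ^ n <= r ^ n) by (apply pow_incr; lra).
    assert (Cmod z * Cmod (pow_d1 z n) <= rho * (r ^ n / (r - rho)))
      by (apply Rmult_le_compat; auto using Cmod_ge_0).
    replace (r * r ^ n / (r - rho)) with (rho * (r ^ n / (r - rho)) + r ^ n)
      by (field; lra).
    lra.
Qed.

(** With X = r^n / (r - rho)^2 the recursion costs at most rho X + (r - rho) X = r X, so each
    further order of differentiation costs one more factor 1 / (r - rho). *)
Lemma pow_d2_bound (z : C) (rho r : R) (n : nat) :
  Cmod z <= rho -> rho < r -> Cmod (pow_d2 z n) <= r ^ n / (r - rho) ^ 2.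
Proof.
  intros Hz Hr. pose proof (Cmod_ge_0 z) as H0.
  induction n as [|n IH]; simpl pow_d2.
  - rewrite Cmod_0. apply Rlt_le, Rdiv_lt_0_compat; [|apply pow_lt]; simpl; lra.
  - eapply Rle_trans; [apply Cmod_triangle|]. rewrite Cmod_mult.
    pose proof (pow_d1_bound z rho r n Hz Hr).
    assert (Cmod z * Cmod (pow_d2 z n) <= rho * (r ^ n / (r - rho) ^ 2))
      by (apply Rmult_le_compat; auto using Cmod_ge_0).
    replace (r ^ S n / (r - rho) ^ 2)
      with (rho * (r ^ n / (r - rho) ^ 2) + r ^ n / (r - rho))
      by (simpl; field; lra).
    lra.
Qed.

(** The remainder e_n satisfies e_(n+1) = (z + h) e_n + h^3 [pow_d2 z n]. The bound depends on n
    only through r^n, so it can be summed against the coefficients of a power series. *)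
Lemma pow_taylor_bound (z h : C) (rho r : R) (n : nat) :
  Cmod z <= rho -> Cmod (z + h)%C <= rho -> rho < r ->
  Cmod ((z + h) ^ n - z ^ n - h * pow_d1 z n - h * h * pow_d2 z n)%C
    <= Cmod h ^ 3 * (r ^ n / (r - rho) ^ 3).
Proof.
  intros Hz Hzh Hr. pose proof (Cmod_ge_0 z) as H0.
  assert (Hh : 0 <= Cmod h ^ 3) by apply pow_le, Cmod_ge_0.
  induction n as [|n IH].
  - simpl Cpow. simpl pow_d1. simpl pow_d2.
    replace (1 - 1 - h * 0 - h * h * 0)%C with (RtoC 0) by ring.
    rewrite Cmod_0. apply Rmult_le_pos; [exact Hh|].
    apply Rlt_le, Rdiv_lt_0_compat; apply pow_lt || rewrite pow_O; lra.
  - set (e := ((z + h) ^ n - z ^ n - h * pow_d1 z n - h * h * pow_d2 z n)%C) in *.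
    replace ((z + h) ^ S n - z ^ S n - h * pow_d1 z (S n) - h * h * pow_d2 z (S n))%C
      with ((z + h) * e + h ^ 3 * pow_d2 z n)%C by (unfold e; simpl; ring).
    eapply Rle_trans; [apply Cmod_triangle|]. rewrite !Cmod_mult, Cmod_pow.
    pose proof (pow_d2_bound z rho r n Hz Hr).
    assert (Cmod (z + h)%C * Cmod e <= rho * (Cmod h ^ 3 * (r ^ n / (r - rho) ^ 3)))
      by (apply Rmult_le_compat; auto using Cmod_ge_0).
    assert (Cmod h ^ 3 * Cmod (pow_d2 z n) <= Cmod h ^ 3 * (r ^ n / (r - rho) ^ 2))
      by (apply Rmult_le_compat_l; auto).
    replace (Cmod h ^ 3 * (r ^ S n / (r - rho) ^ 3))
      with (rho * (Cmod h ^ 3 * (r ^ n / (r - rho) ^ 3))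
            + Cmod h ^ 3 * (r ^ n / (r - rho) ^ 2)) by (simpl; field; lra).
    lra.
Qed.

(** Termwise Taylor expansion. The first coefficient is identified with the differentiated series so
    that it can later be compared with a derivative given by [is_derive]. *)
Lemma pseries_on_disc_jet (a : nat -> C) (F : C -> C) (z : C) :
  pseries_on_disc a F -> Cmod z < 1 ->
  exists (c1 c2 : C) (K d : R), 0 < d /\
    is_pseries (fun n => INR (S n) * a (S n))%C z c1 /\
    forall h, Cmod h < d ->
      Cmod (F (z + h)%C - F z - h * c1 - h * h * c2)%C <= K * Cmod h ^ 3.
Proof.
  intros HF Hz. pose proof (Cmod_ge_0 z) as H0.
  (* Two radii between |z| and 1: z + h stays within [rho], and the larger [r] absorbs the
     polynomial growth in n while the series still converges absolutely there. *)
  set (rho := (1 + Cmod z) / 2). set (r := (1 + rho) / 2).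
  assert (Hrho : Cmod z < rho < 1) by (unfold rho; lra).
  assert (Hr : rho < r < 1) by (unfold r; lra).
  assert (Habs := pseries_on_disc_abs a F r HF ltac:(lra)).
  assert (Hex : forall (u : nat -> C) (k : R),
    (forall n, Cmod (u n) <= r ^ n / k) -> 
    exists l : C, is_series (fun n => a n * u n)%C l).
  { intros u k Hu.
    apply (ex_series_le (K := C_AbsRing) (V := C_CompleteNormedModule) _
             (fun n => / k * (Cmod (a n) * r ^ n))).
    - intros n. change (Cmod (a n * u n)%C <= / k * (Cmod (a n) * r ^ n)).
      rewrite Cmod_mult.
      replace (/ k * (Cmod (a n) * r ^ n)) with (Cmod (a n) * (r ^ n / k))
        by (unfold Rdiv; ring).
      apply Rmult_le_compat_l; auto using Cmod_ge_0.
    - apply (ex_series_Rmult_l (/ k)), Habs. }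
  destruct (Hex (pow_d1 z) (r - rho)) as [c1 Hc1].
  { intros n; apply pow_d1_bound; lra. }
  destruct (Hex (pow_d2 z) ((r - rho) ^ 2)) as [c2 Hc2].
  { intros n; apply pow_d2_bound; lra. }
  exists c1, c2, (Series (fun n => / (r - rho) ^ 3 * (Cmod (a n) * r ^ n))), (rho - Cmod z).
  split; [lra|]. split.
  - apply is_pseries_Cpow.
    apply (is_series_ext (fun n => a (S n) * pow_d1 z (S n))%C).
    { intros n. rewrite pow_d1_S.
      change (a (S n) * (INR (S n) * z ^ n) = INR (S n) * a (S n) * z ^ n)%C. ring. }
    apply (is_series_incr_1 (fun n => a n * pow_d1 z n)%C).
    match goal with |- is_series _ ?l => replace l with c1 end; [exact Hc1|].
    change (c1 = c1 + a O * 0)%C. ring.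
  - intros h Hh.
    assert (Hzh : Cmod (z + h)%C <= rho)
      by (eapply Rle_trans; [apply Cmod_triangle|lra]).
    assert (S0 := proj1 (is_pseries_Cpow _ _ _) (HF z Hz)).
    assert (S1 := proj1 (is_pseries_Cpow _ _ _) (HF (z + h)%C ltac:(lra))).
    assert (S2 := is_series_scal (K := C_AbsRing) h _ _ Hc1).
    assert (S3 := is_series_scal (K := C_AbsRing) (h * h)%C _ _ Hc2).
    assert (S4 := is_series_minus _ _ _ _ (is_series_minus _ _ _ _
                    (is_series_minus _ _ _ _ S1 S0) S2) S3).
    rewrite Rmult_comm, <- Series_scal_l.
    refine (is_series_Cmod_le _ _ _ S4 _ _).
    + intros n.
      change (Cmod (a n * (z + h) ^ n - a n * z ^ n - h * (a n * pow_d1 z n)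
                    - h * h * (a n * pow_d2 z n))%C
              <= Cmod h ^ 3 * (/ (r - rho) ^ 3 * (Cmod (a n) * r ^ n))).
      replace (a n * (z + h) ^ n - a n * z ^ n - h * (a n * pow_d1 z n)
                    - h * h * (a n * pow_d2 z n))%C
        with (a n * ((z + h) ^ n - z ^ n - h * pow_d1 z n - h * h * pow_d2 z n))%C by ring.
      rewrite Cmod_mult.
      replace (Cmod h ^ 3 * (/ (r - rho) ^ 3 * (Cmod (a n) * r ^ n)))
        with (Cmod (a n) * (Cmod h ^ 3 * (r ^ n / (r - rho) ^ 3)))
        by (unfold Rdiv; ring).
      apply Rmult_le_compat_l; [apply Cmod_ge_0|].
      apply pow_taylor_bound; lra.
    + apply (ex_series_Rmult_l (Cmod h ^ 3)),
        (ex_series_Rmult_l (/ (r - rho) ^ 3)), Habs.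
Qed.

(** * The maximum modulus principle *)

Definition bigO (k : nat) (g : C -> C) : Prop :=
  exists K d : R, 0 < d /\ forall h, Cmod h < d -> Cmod (g h) <= K * Cmod h ^ k.

Lemma bigO_ext (k : nat) (f g : C -> C) :
  (forall h, f h = g h) -> bigO k f -> bigO k g.
Proof. intros E (K & d & Hd & H). exists K, d. split; [exact Hd|]. intros h. rewrite <- E. apply H. Qed.

Lemma bigO_plus (k : nat) (f g : C -> C) :
  bigO k f -> bigO k g -> bigO k (fun h => f h + g h)%C.
Proof.
  intros (K & d & Hd & H) (K' & d' & Hd' & H').
  exists (K + K'), (Rmin d d'). split; [now apply Rmin_pos|]. intros h Hh.
  pose proof (Rmin_l d d'). pose proof (Rmin_r d d').
  eapply Rle_trans; [apply Cmod_triangle|].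
  specialize (H h ltac:(lra)). specialize (H' h ltac:(lra)). lra.
Qed.

Lemma bigO_mult (j k : nat) (f g : C -> C) :
  bigO j f -> bigO k g -> bigO (j + k) (fun h => f h * g h)%C.
Proof.
  intros (K & d & Hd & H) (K' & d' & Hd' & H').
  exists (K * K'), (Rmin d d'). split; [now apply Rmin_pos|]. intros h Hh.
  pose proof (Rmin_l d d'). pose proof (Rmin_r d d').
  specialize (H h ltac:(lra)). specialize (H' h ltac:(lra)).
  rewrite Cmod_mult, pow_add.
  replace (K * K' * (Cmod h ^ j * Cmod h ^ k))
    with ((K * Cmod h ^ j) * (K' * Cmod h ^ k)) by ring.
  apply Rmult_le_compat; auto using Cmod_ge_0.
Qed.

Lemma bigO_const (c : C) : bigO 0 (fun _ => c).
Proof. exists (Cmod c), 1. split; [lra|]. intros h _. simpl. lra. Qed.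

Lemma bigO_opp (k : nat) (f : C -> C) : bigO k f -> bigO k (fun h => - f h)%C.
Proof.
  intros H. apply (bigO_ext k (fun h => - (1) * f h)%C); [intros; ring|].
  exact (bigO_mult 0 k _ _ (bigO_const _) H).
Qed.

Lemma bigO_id : bigO 1 (fun h => h).
Proof. exists 1, 1. split; [lra|]. intros h _. simpl. lra. Qed.

Lemma bigO_weaken (k : nat) (f : C -> C) : bigO (S k) f -> bigO k f.
Proof.
  intros (K & d & Hd & H). exists (Rabs K), (Rmin d 1).
  split; [apply Rmin_pos; lra|]. intros h Hh.
  pose proof (Rmin_l d 1). pose proof (Rmin_r d 1). pose proof (Cmod_ge_0 h).
  eapply Rle_trans; [apply H; lra|]. simpl.
  rewrite <- Rmult_assoc. apply Rmult_le_compat_r; [apply pow_le; lra|].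
  pose proof (Rle_abs K). pose proof (Rabs_pos K). nra.
Qed.

(** All the regularity that the maximum principle uses. Order two is the right order: the
    perturbation eps |z|^2 gains a multiple of t^2 in the four-point average, so the error must be
    of order t^3. *)
Definition jet2 (F : C -> C) (z : C) : Prop :=
  exists c1 c2 : C, bigO 3 (fun h => F (z + h) - F z - h * c1 - h * h * c2)%C.

Lemma jet2_increment (F : C -> C) (z : C) :
  jet2 F z -> bigO 1 (fun h => F (z + h) - F z)%C.
Proof.
  intros (c1 & c2 & H).
  apply (bigO_ext 1 (fun h => (F (z + h) - F z - h * c1 - h * h * c2) +
     (h * c1 + h * (h * c2)))%C); [intros; ring|].
  apply bigO_plus; [now apply bigO_weaken, bigO_weaken|].
  apply bigO_plus.
  - exact (bigO_mult 1 0 _ _ bigO_id (bigO_const _)).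
  - exact (bigO_mult 1 0 _ _ bigO_id (bigO_weaken 0 _
      (bigO_mult 1 0 _ _ bigO_id (bigO_const _)))).
Qed.

(** Near [z] the increment of [D] is below half of |D z|, so |D| stays above that half. The factor
    [Cmod h ^ 0] is 1 and only keeps the shape of a [bigO 0] bound. *)
Lemma bigO_inv (D : C -> C) (z : C) :
  D z <> 0%C -> bigO 1 (fun h => D (z + h) - D z)%C ->
  exists K d : R, 0 < d /\ forall h, Cmod h < d ->
    D (z + h)%C <> 0%C /\ Cmod (/ D (z + h)%C)%C <= K * Cmod h ^ 0.
Proof.
  intros H0 (K & d & Hd & H). apply Cmod_gt_0 in H0.
  set (m := Cmod (D z)) in *.
  assert (HK : 0 < Rabs K + 1) by (pose proof (Rabs_pos K); lra).
  exists (2 / m), (Rmin d (m / (2 * (Rabs K + 1)))). split.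
  { apply Rmin_pos; [exact Hd|]. apply Rdiv_lt_0_compat; lra. }
  intros h Hh.
  assert (H1 : Cmod h < m / (2 * (Rabs K + 1)))
    by (eapply Rlt_le_trans; [exact Hh|apply Rmin_r]).
  assert (H2 : Cmod h < d) by (eapply Rlt_le_trans; [exact Hh|apply Rmin_l]).
  specialize (H h H2). rewrite pow_1 in H.
  apply (Rmult_lt_compat_r (2 * (Rabs K + 1))) in H1; [|lra].
  unfold Rdiv in H1. rewrite Rmult_assoc, Rinv_l, Rmult_1_r in H1 by lra.
  assert (K * Cmod h <= Rabs K * Cmod h)
    by (apply Rmult_le_compat_r; [apply Cmod_ge_0|apply Rle_abs]).
  pose proof (Cmod_ge_0 h).
  assert (H5 : m <= Cmod (D (z + h)%C) + Cmod (D (z + h) - D z)%C).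
  { unfold m. replace (D z) with (D (z + h) + - (D (z + h) - D z))%C at 1 by ring.
    eapply Rle_trans; [apply Cmod_triangle|]. rewrite Cmod_opp. lra. }
  assert (H6 : m / 2 < Cmod (D (z + h)%C)) by nra.
  assert (H7 : D (z + h)%C <> 0%C) by (apply Cmod_gt_0; lra).
  split; [exact H7|]. rewrite Cmod_inv by exact H7. simpl. rewrite Rmult_1_r.
  replace (2 / m) with (/ (m / 2)) by (field; lra).
  apply Rinv_le_contravar; lra.
Qed.

Lemma jet2_div (N D : C -> C) (z : C) :
  jet2 N z -> jet2 D z -> D z <> 0%C -> jet2 (fun w => N w / D w)%C z.
Proof.
  intros (n1 & n2 & HN) HD H0. pose proof (jet2_increment _ _ HD) as Hinc.
  destruct HD as (d1 & d2 & HD).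
  (* Division of the two jets: [F0], [e1], [e2] solve N = (F0 + h e1 + h^2 e2) D degree by degree up
     to h^2. *)
  set (F0 := (N z / D z)%C). set (e1 := ((n1 - F0 * d1) / D z)%C).
  set (e2 := ((n2 - F0 * d2 - e1 * d1) / D z)%C).
  exists e1, e2.
  assert (Hh2 : forall c, bigO 1 (fun h => h * c)%C)
    by (intros c; exact (bigO_mult 1 0 _ _ bigO_id (bigO_const _))).
  assert (Hnum : bigO 3 (fun h => N (z + h) - (F0 + h * e1 + h * h * e2) * D (z + h))%C).
  { apply (bigO_ext 3 (fun h => (N (z + h) - N z - h * n1 - h * h * n2)
       + - ((F0 + (h * e1 + h * (h * e2))) * (D (z + h) - D z - h * d1 - h * h * d2))
       + - (h * (h * (h * (e1 * d2 + e2 * d1 + h * (e2 * d2))))))%C).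
    { intros h. unfold e2, e1, F0. field. exact H0. }
    apply bigO_plus; [apply bigO_plus; [exact HN|]|]; apply bigO_opp.
    - refine (bigO_mult 0 3 _ _ _ HD).
      apply bigO_plus; [apply bigO_const|]. apply bigO_plus; [apply bigO_weaken, Hh2|].
      apply bigO_weaken, bigO_weaken. refine (bigO_mult 1 1 _ _ bigO_id (Hh2 _)).
    - refine (bigO_mult 1 2 _ _ bigO_id _). refine (bigO_mult 1 1 _ _ bigO_id _).
      refine (bigO_mult 1 0 _ _ bigO_id _).
      apply bigO_plus; [apply bigO_const|apply bigO_weaken, Hh2]. }
  destruct (bigO_inv D z H0 Hinc) as (K & d & Hd & HK).
  destruct Hnum as (K' & d' & Hd' & HK').
  exists (K' * K), (Rmin d d'). split; [now apply Rmin_pos|]. intros h Hh.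
  pose proof (Rmin_l d d'). pose proof (Rmin_r d d').
  destruct (HK h ltac:(lra)) as [Hnz Hle]. specialize (HK' h ltac:(lra)).
  fold F0.
  replace (N (z + h) / D (z + h) - F0 - h * e1 - h * h * e2)%C
    with ((N (z + h) - (F0 + h * e1 + h * h * e2) * D (z + h)) * / D (z + h))%C
    by (field; exact Hnz).
  rewrite Cmod_mult.
  replace (K' * K * Cmod h ^ 3) with ((K' * Cmod h ^ 3) * (K * Cmod h ^ 0)) by (simpl; ring).
  apply Rmult_le_compat; [apply Cmod_ge_0|apply Cmod_ge_0|exact HK'|exact Hle].
Qed.

(* The four steps +-t, +-it kill the terms of degree 1 and 2 in the sum. *)
Lemma jet2_four_point (F : C -> C) (z : C) :
  jet2 F z -> exists K d : R, 0 < d /\ forall t, 0 < t < d ->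
    4 * Cmod (F z) - K * t ^ 3 <=
      Cmod (F (z + t)%C) + Cmod (F (z + - t)%C)
      + Cmod (F (z + Ci * t)%C) + Cmod (F (z + - (Ci * t))%C).
Proof.
  intros (c1 & c2 & K & d & Hd & H). exists (4 * K), d. split; [exact Hd|].
  intros t Ht.
  assert (Ht1 : Cmod (RtoC t) = t) by (rewrite Cmod_R; apply Rabs_pos_eq; lra).
  assert (Ht2 : Cmod (Ci * t)%C = t) by (rewrite Cmod_mult, Cmod_Ci, Ht1; ring).
  assert (Ht3 := Cmod_opp t). assert (Ht4 := Cmod_opp (Ci * t)%C).
  assert (E1 := H (RtoC t) ltac:(lra)). assert (E2 := H (- t)%C ltac:(lra)).
  assert (E3 := H (Ci * t)%C ltac:(lra)). assert (E4 := H (- (Ci * t))%C ltac:(lra)).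
  rewrite Ht4, Ht2 in E4. rewrite Ht3, Ht1 in E2. rewrite Ht1 in E1. rewrite Ht2 in E3.
  set (r1 := (F (z + t) - F z - t * c1 - t * t * c2)%C) in *.
  set (r2 := (F (z + - t) - F z - - t * c1 - - t * - t * c2)%C) in *.
  set (r3 := (F (z + Ci * t) - F z - Ci * t * c1 - Ci * t * (Ci * t) * c2)%C) in *.
  set (r4 := (F (z + - (Ci * t)) - F z - - (Ci * t) * c1
               - - (Ci * t) * - (Ci * t) * c2)%C) in *.
  assert (HCi : (Ci * Ci = - (1))%C)
    by (apply injective_projections; simpl; ring).
  assert (E : (4 * F z = F (z + t) + F (z + - t) + F (z + Ci * t) + F (z + - (Ci * t))
               + - r1 + - r2 + - r3 + - r4)%C).
  { unfold r1, r2, r3, r4.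
    match goal with |- ?l = ?r =>
      replace r with (l + 2 * t * t * c2 * (1 + Ci * Ci))%C by ring end.
    rewrite HCi. ring. }
  assert (E5 : 4 * Cmod (F z) = Cmod (4 * F z)%C).
  { rewrite Cmod_mult, Cmod_R, Rabs_pos_eq; lra. }
  rewrite E5, E.
  assert (T : forall x y, Cmod (x + - y)%C <= Cmod x + Cmod y)
    by (intros x y; rewrite <- (Cmod_opp y); apply Cmod_triangle).
  set (s := (F (z + t) + F (z + - t) + F (z + Ci * t) + F (z + - (Ci * t)))%C).
  pose proof (T (s + - r1 + - r2 + - r3)%C r4). pose proof (T (s + - r1 + - r2)%C r3).
  pose proof (T (s + - r1)%C r2). pose proof (T s r1).
  assert (Cmod s <= Cmod (F (z + t)%C) + Cmod (F (z + - t)%C)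
      + Cmod (F (z + Ci * t)%C) + Cmod (F (z + - (Ci * t))%C)).
  { unfold s. eapply Rle_trans; [apply Cmod_triangle|]. apply Rplus_le_compat_r.
    eapply Rle_trans; [apply Cmod_triangle|]. apply Rplus_le_compat_r, Cmod_triangle. }
  lra.
Qed.

(** Compactness of the disc, for a [g] that need not be continuous. One number [d] serves as radius
    and as lower bound, so a positive lower bound for the gauge over a covering square bounds [g] as
    well. *)
Lemma closed_disc_local_lower_bound (r : R) (g : C -> R) :
  (forall z, Cmod z <= r -> exists d, 0 < d /\
     forall w, Cmod w <= r -> Cmod (w - z)%C < d -> d <= g w) ->
  exists d, 0 < d /\ forall w, Cmod w <= r -> d <= g w.
Proof.
  intros Hloc.
  assert (H : forall x y : R, exists d : posreal, forall w, Cmod w <= r ->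
            Rabs (Re w - x) < d -> Rabs (Im w - y) < d -> d <= g w).
  { intros x y.
    assert (Hsum : forall w : C, Cmod (w - (x, y))%C <= Rabs (Re w - x) + Rabs (Im w - y)).
    { intros w. replace (w - (x, y))%C with (RtoC (Re w - x) + Ci * RtoC (Im w - y))%C
        by (destruct w; apply injective_projections; simpl; ring).
      eapply Rle_trans; [apply Cmod_triangle|].
      rewrite Cmod_mult, Cmod_Ci, !Cmod_R. lra. }
    destruct (Rle_dec (Cmod (x, y)) r) as [Hle|Hgt].
    - destruct (Hloc (x, y) Hle) as (d & Hd & H).
      assert (Hd2 : 0 < d / 2) by lra. exists (mkposreal _ Hd2); simpl.
      intros w Hw Hx Hy. specialize (H w Hw). pose proof (Hsum w).
      specialize (H ltac:(lra)). lra.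
    (* A point outside the disc gets a neighbourhood that misses the disc, so its condition is
       vacuous. *)
    - assert (Hd2 : 0 < (Cmod (x, y) - r) / 2) by lra. exists (mkposreal _ Hd2); simpl.
      intros w Hw Hx Hy. exfalso. pose proof (Hsum w).
      assert (Cmod (x, y) <= Cmod w + Cmod (w - (x, y))%C).
      { replace (x, y) with (w + - (w - (x, y)))%C at 1 by ring.
        eapply Rle_trans; [apply Cmod_triangle|]. rewrite Cmod_opp. lra. }
      lra. }
  set (delta x y := proj1_sig (constructive_indefinite_description _ (H x y))).
  destruct (compactness_value_2d (- r) r (- r) r delta) as [d Hd].
  exists d. split; [apply cond_pos|]. intros w Hw.
  (* [compactness_value_2d] yields its nearby centre only under a double negation, so the inequality
     is proved by contradiction. *)
  destruct (Rle_dec d (g w)) as [Hle|Hn]; [exact Hle|exfalso].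
  assert (HRI := Rmax_Cmod w).
  assert (Rabs (Re w) <= r) by (eapply Rle_trans; [apply Rmax_l|]; eapply Rle_trans; eassumption).
  assert (Rabs (Im w) <= r) by (eapply Rle_trans; [apply Rmax_r|]; eapply Rle_trans; eassumption).
  apply (Hd (Re w) (Im w)); [now apply Rabs_le_between|now apply Rabs_le_between|].
  intros (u & v & _ & _ & Hu & Hv & Hduv). apply Hn.
  eapply Rle_trans; [exact Hduv|].
  exact (proj2_sig (constructive_indefinite_description _ (H u v)) w Hw Hu Hv).
Qed.

(** Weierstrass for upper semicontinuous functions, by two uses of the local lower bound. Applied to
    exp(-u) it bounds [u] above. If the supremum [M] were not attained, M - u would be positive,
    hence at least some e > 0 throughout, and M - e would be a smaller upper bound. *)
Lemma closed_disc_attains_max (r : R) (u : C -> R) :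
  0 <= r ->
  (forall z, Cmod z <= r -> forall e, 0 < e -> exists d, 0 < d /\
     forall w, Cmod w <= r -> Cmod (w - z)%C < d -> u w <= u z + e) ->
  exists z0, Cmod z0 <= r /\ forall w, Cmod w <= r -> u w <= u z0.
Proof.
  intros Hr Husc.
  destruct (closed_disc_local_lower_bound r (fun w => exp (- u w))) as (d & Hd & Hb).
  { intros z Hz. destruct (Husc z Hz 1 Rlt_0_1) as (d & Hd & H).
    exists (Rmin d (exp (- (u z + 1)))). split; [apply Rmin_pos; [exact Hd|apply exp_pos]|].
    intros w Hw Hwz. pose proof (Rmin_l d (exp (- (u z + 1)))).
    eapply Rle_trans; [apply Rmin_r|]. specialize (H w Hw ltac:(lra)).
    destruct (Rle_lt_or_eq_dec _ _ H) as [Hlt|He].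
    - apply Rlt_le, exp_increasing. lra.
    - rewrite He. lra. }
  destruct (completeness (fun x => exists w, Cmod w <= r /\ x = u w)) as [M [HM1 HM2]].
  { exists (- ln d). intros x (w & Hw & ->). specialize (Hb w Hw).
    apply Ropp_le_cancel. rewrite Ropp_involutive, <- (ln_exp (- u w)).
    destruct (Rle_lt_or_eq_dec _ _ Hb) as [Hlt|He].
    - now apply Rlt_le, ln_increasing.
    - rewrite He. lra. }
  { exists (u 0%C), 0%C. rewrite Cmod_0. auto. }
  destruct (excluded_middle_informative
    (exists z0, Cmod z0 <= r /\ forall w, Cmod w <= r -> u w <= u z0)) as [Hy|Hn]; [exact Hy|exfalso].
  assert (Hlt : forall z, Cmod z <= r -> u z < M).
  { intros z Hz. destruct (Rlt_dec (u z) M) as [Hl|Hge]; [exact Hl|exfalso].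
    apply Hn. exists z. split; [exact Hz|]. intros w Hw.
    assert (u w <= M) by (apply HM1; eauto). lra. }
  destruct (closed_disc_local_lower_bound r (fun w => M - u w)) as (e & He & Hbe).
  { intros z Hz. specialize (Hlt z Hz).
    destruct (Husc z Hz ((M - u z) / 2) ltac:(lra)) as (d' & Hd' & H).
    exists (Rmin d' ((M - u z) / 2)). split; [apply Rmin_pos; lra|].
    intros w Hw Hwz. pose proof (Rmin_l d' ((M - u z) / 2)).
    eapply Rle_trans; [apply Rmin_r|]. specialize (H w Hw ltac:(lra)). lra. }
  assert (M <= M - e); [|lra].
  apply HM2. intros x (w & Hw & ->). specialize (Hbe w Hw). lra.
Qed.

Lemma Cmod2_four_point (z : C) (t : R) :
  Cmod (z + t)%C ^ 2 + Cmod (z + - t)%C ^ 2 + Cmod (z + Ci * t)%C ^ 2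
    + Cmod (z + - (Ci * t))%C ^ 2 = 4 * Cmod z ^ 2 + 4 * t ^ 2.
Proof. rewrite !Cmod2_alt. destruct z as [x y]. simpl. ring. Qed.

(* Adding eps |z|^2 makes [jet2_four_point] strict, which rules out interior maxima. *)
Lemma maximum_modulus (F : C -> C) (r B : R) :
  0 <= r -> (forall z, Cmod z <= r -> jet2 F z) ->
  (forall z, Cmod z = r -> Cmod (F z) <= B) ->
  forall z, Cmod z <= r -> Cmod (F z) <= B.
Proof.
  intros Hr HF HB z Hz. apply le_epsilon. intros eps0 Heps0.
  (* Chosen so that eps |z|^2 is at most [eps0] on the whole disc. *)
  set (eps := eps0 / (1 + r ^ 2)).
  assert (Hr2 : 0 <= r ^ 2) by apply pow2_ge_0.
  assert (Heps : 0 < eps) by (apply Rdiv_lt_0_compat; lra).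
  set (u w := Cmod (F w) + eps * Cmod w ^ 2).
  assert (Hsub : forall w, Cmod (w - 0)%C = Cmod w) by (intros w; f_equal; ring).
  destruct (closed_disc_attains_max r u Hr) as (z0 & Hz0 & Hmax).
  { intros w Hw e He. destruct (jet2_increment F w (HF w Hw)) as (K & d & Hd & H).
    (* A local Lipschitz constant for [u]: |K| from F, 2 eps r from eps |w|^2, and 1 to keep it
       positive. *)
    set (L := Rabs K + 2 * eps * r + 1).
    assert (HL : 1 <= L).
    { unfold L. pose proof (Rabs_pos K).
      assert (0 <= eps * r) by (apply Rmult_le_pos; lra). lra. }
    exists (Rmin d (e / L)). split.
    { apply Rmin_pos; [exact Hd|apply Rdiv_lt_0_compat; lra]. }
    intros v Hv Hvw. set (h := (v - w)%C) in *.
    assert (Hv' : v = (w + h)%C) by (unfold h; ring).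
    assert (H1 : Cmod h < e / L) by (eapply Rlt_le_trans; [exact Hvw|apply Rmin_r]).
    assert (H2 : Cmod h < d) by (eapply Rlt_le_trans; [exact Hvw|apply Rmin_l]).
    specialize (H h H2). rewrite <- Hv', pow_1 in H.
    apply (Rmult_lt_compat_r L) in H1; [|lra].
    unfold Rdiv in H1. rewrite Rmult_assoc, Rinv_l, Rmult_1_r in H1 by lra.
    pose proof (Cmod_ge_0 h) as Hh0. pose proof (Cmod_ge_0 v) as Hv0.
    pose proof (Cmod_ge_0 w) as Hw0.
    assert (H3 : Cmod (F v) <= Cmod (F v - F w)%C + Cmod (F w)).
    { replace (F v) with ((F v - F w) + F w)%C at 1 by ring. apply Cmod_triangle. }
    assert (H4 : Cmod v <= Cmod w + Cmod h)
      by (rewrite Hv'; apply Cmod_triangle).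
    assert (H5 : K * Cmod h <= Rabs K * Cmod h)
      by (apply Rmult_le_compat_r; [exact Hh0|apply Rle_abs]).
    assert (H6 : Cmod v ^ 2 - Cmod w ^ 2 <= 2 * r * Cmod h).
    { replace (Cmod v ^ 2 - Cmod w ^ 2) with ((Cmod v + Cmod w) * (Cmod v - Cmod w)) by ring.
      destruct (Rle_dec (Cmod v) (Cmod w)); [nra|]. apply Rmult_le_compat; lra. }
    assert (H7 : eps * (Cmod v ^ 2 - Cmod w ^ 2) <= eps * (2 * r * Cmod h))
      by (apply Rmult_le_compat_l; lra).
    unfold u, L in *. nra. }
  assert (Hz0r : Cmod z0 = r).
  { destruct (Rle_lt_or_eq_dec _ _ Hz0) as [Hlt|He]; [exfalso|exact He].
    destruct (jet2_four_point F z0 (HF z0 Hz0)) as (K & d & Hd & H).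
    (* The three bounds keep [t] within the range of the expansion, keep the four points in the
       disc, and make K t^3 <= eps t^2, less than the gain 4 eps t^2. *)
    set (t := Rmin (d / 2) (Rmin (r - Cmod z0) (eps / (Rabs K + 1)))).
    assert (HK := Rabs_pos K).
    assert (Ht0 : 0 < t).
    { repeat apply Rmin_pos; try lra. apply Rdiv_lt_0_compat; lra. }
    assert (Ht1 : t < d) by (eapply Rle_lt_trans; [apply Rmin_l|lra]).
    assert (Ht2 : t <= r - Cmod z0)
      by (eapply Rle_trans; [apply Rmin_r|apply Rmin_l]).
    assert (Ht3 : t <= eps / (Rabs K + 1))
      by (eapply Rle_trans; [apply Rmin_r|apply Rmin_r]).
    apply (Rmult_le_compat_r (Rabs K + 1)) in Ht3; [|lra].
    unfold Rdiv in Ht3. rewrite Rmult_assoc, Rinv_l, Rmult_1_r in Ht3 by lra.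
    specialize (H t (conj Ht0 Ht1)).
    assert (Hn1 : Cmod (RtoC t) = t) by (rewrite Cmod_R; apply Rabs_pos_eq; lra).
    assert (Hn2 : Cmod (Ci * t)%C = t) by (rewrite Cmod_mult, Cmod_Ci, Hn1; ring).
    assert (Hin : forall h, Cmod h = t -> Cmod (z0 + h)%C <= r).
    { intros h Hh. eapply Rle_trans; [apply Cmod_triangle|]. lra. }
    pose proof (Hmax _ (Hin _ Hn1)) as M1.
    pose proof (Hmax _ (Hin _ (eq_trans (Cmod_opp _) Hn1))) as M2.
    pose proof (Hmax _ (Hin _ Hn2)) as M3.
    pose proof (Hmax _ (Hin _ (eq_trans (Cmod_opp _) Hn2))) as M4.
    unfold u in M1, M2, M3, M4. pose proof (Cmod2_four_point z0 t) as HQ.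
    assert (H8 : K * t ^ 3 <= (Rabs K * t) * t ^ 2).
    { replace (K * t ^ 3) with (K * (t ^ 3)) by ring.
      replace (Rabs K * t * t ^ 2) with (Rabs K * t ^ 3) by ring.
      apply Rmult_le_compat_r; [apply pow_le; lra|apply Rle_abs]. }
    assert (H9 : Rabs K * t * t ^ 2 <= eps * t ^ 2)
      by (apply Rmult_le_compat_r; [apply pow2_ge_0|nra]).
    assert (H10 : 0 < t ^ 2) by (apply pow_lt; lra).
    assert (H11 : 0 < eps * t ^ 2) by (apply Rmult_lt_0_compat; lra).
    assert (HQ' : eps * Cmod (z0 + t)%C ^ 2 + eps * Cmod (z0 + - t)%C ^ 2
      + eps * Cmod (z0 + Ci * t)%C ^ 2 + eps * Cmod (z0 + - (Ci * t))%C ^ 2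
      = 4 * (eps * Cmod z0 ^ 2) + 4 * (eps * t ^ 2)).
    { rewrite <- !Rmult_plus_distr_l, HQ. ring. }
    lra. }
  specialize (Hmax z Hz). specialize (HB z0 Hz0r). unfold u in Hmax.
  rewrite Hz0r in Hmax.
  assert (0 <= eps * Cmod z ^ 2) by (apply Rmult_le_pos; [lra|apply pow2_ge_0]).
  assert (eps * r ^ 2 <= eps0).
  { unfold eps. apply (Rmult_le_reg_r (1 + r ^ 2)); [lra|].
    replace (eps0 / (1 + r ^ 2) * r ^ 2 * (1 + r ^ 2)) with (eps0 * r ^ 2) by (field; lra).
    nra. }
  lra.
Qed.

(** * The Schwarz lemma and Schur's algorithm *)

Lemma pseries_on_disc_jet2 (a : nat -> C) (F : C -> C) (z : C) :
  pseries_on_disc a F -> Cmod z < 1 -> jet2 F z.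
Proof.
  intros HF Hz. destruct (pseries_on_disc_jet a F z HF Hz) as (c1 & c2 & K & d & Hd & _ & H).
  exists c1, c2, K, d. auto.
Qed.

Lemma pseries_on_disc_0 (a : nat -> C) (F : C -> C) :
  pseries_on_disc a F -> F 0%C = a O.
Proof.
  intros HF.
  assert (H := HF 0%C ltac:(rewrite Cmod_0; lra)).
  refine (filterlim_locally_unique (K := C_AbsRing) (V := C_NormedModule) _ _ _ H _).
  exact (is_pseries_0 (K := C_AbsRing) (V := C_NormedModule) a).
Qed.

Lemma pseries_on_disc_shift (a : nat -> C) (F : C -> C) :
  pseries_on_disc a F ->
  exists G, pseries_on_disc (fun n => a (S n)) G /\ forall z, F z = (a O + z * G z)%C.
Proof.
  intros HF.
  (* The removable singularity at 0 is filled with the value [a 1], so the factorisation holds at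
     every z. *)
  exists (fun z : C => if excluded_middle_informative (z = 0%C) then a 1%nat else ((F z - a O) / z)%C).
  split; intros z; [intros Hz|]; destruct (excluded_middle_informative (z = 0%C)) as [->|Hnz].
  - exact (is_pseries_0 (K := C_AbsRing) (V := C_NormedModule) (fun n => a (S n))).
  - assert (H := is_pseries_decr_1 (K := C_AbsRing) (V := C_NormedModule) a z (/ z)%C (F z)
                   (Cinv_l z Hnz) (HF z Hz)).
    replace ((F z - a O) / z)%C with (/ z * (F z - a O))%C by (field; exact Hnz).
    exact H.
  - rewrite (pseries_on_disc_0 a F HF). ring.
  - field. exact Hnz.
Qed.

Lemma pseries_on_disc_lin (x y : C) (a b : nat -> C) (F G : C -> C) :
  pseries_on_disc a F -> pseries_on_disc b G ->
  pseries_on_disc (fun n => x * a n + y * b n)%C (fun z => x * F z + y * G z)%C.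
Proof.
  intros HF HG z Hz.
  exact (is_pseries_plus (K := C_AbsRing) (V := C_NormedModule) _ _ _ _ _
    (is_pseries_scal (K := C_AbsRing) (V := C_NormedModule) x a z _ (Cmult_comm _ _) (HF z Hz))
    (is_pseries_scal (K := C_AbsRing) (V := C_NormedModule) y b z _ (Cmult_comm _ _) (HG z Hz))).
Qed.

(** Uniqueness of the derivative: the expansion has slope [c1], [is_derive] has slope [l], and one
    small real increment separates them if they differ. *)
Lemma pseries_on_disc_derive (a : nat -> C) (F : C -> C) (z l : C) :
  pseries_on_disc a F -> Cmod z < 1 -> is_derive F z l ->
  is_pseries (fun n => INR (S n) * a (S n))%C z l.
Proof.
  intros HF Hz [_ HD].
  destruct (pseries_on_disc_jet a F z HF Hz) as (c1 & c2 & K & d & Hd & Hc1 & H).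
  assert (HO : bigO 2 (fun h => F (z + h) - F z - h * c1)%C).
  { apply (bigO_ext 2 (fun h => (F (z + h) - F z - h * c1 - h * h * c2) + h * (h * c2))%C);
      [intros; ring|].
    apply bigO_plus; [apply bigO_weaken; exists K, d; auto|].
    refine (bigO_mult 1 1 _ _ bigO_id _). exact (bigO_mult 1 0 _ _ bigO_id (bigO_const _)). }
  clear K d Hd H. destruct HO as (K & d & Hd & H).
  replace l with c1; [exact Hc1|].
  destruct (excluded_middle_informative (c1 = l)) as [He|Hn]; [exact He|exfalso].
  assert (Hm : 0 < Cmod (l - c1)%C).
  { apply Cmod_gt_0. intros E. apply Hn. rewrite <- (Cplus_0_r c1), <- E. ring. }
  set (m := Cmod (l - c1)%C) in *.
  assert (Hm3 : 0 < m / 3) by lra.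
  destruct (HD z (fun P HP => HP) (mkposreal _ Hm3)) as [e He]. simpl in He.
  assert (HK := Rabs_pos K).
  set (t := Rmin (d / 2) (Rmin (e / 2) (m / 3 / (Rabs K + 1)))).
  assert (Hepos := cond_pos e).
  assert (Ht0 : 0 < t).
  { repeat apply Rmin_pos; try lra. apply Rdiv_lt_0_compat; lra. }
  assert (Ht1 : t < d) by (eapply Rle_lt_trans; [apply Rmin_l|lra]).
  assert (Ht2 : t < e)
    by (eapply Rle_lt_trans; [apply Rmin_r|eapply Rle_lt_trans; [apply Rmin_l|lra]]).
  assert (Ht3 : t <= m / 3 / (Rabs K + 1))
    by (eapply Rle_trans; [apply Rmin_r|apply Rmin_r]).
  apply (Rmult_le_compat_r (Rabs K + 1)) in Ht3; [|lra].
  replace (m / 3 / (Rabs K + 1) * (Rabs K + 1)) with (m / 3) in Ht3 by (field; lra).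
  assert (Hn1 : Cmod (RtoC t) = t) by (rewrite Cmod_R; apply Rabs_pos_eq; lra).
  specialize (H (RtoC t) ltac:(lra)). rewrite Hn1 in H.
  assert (Hdiff : (z + t - z = t)%C) by ring.
  specialize (He (z + t)%C).
  assert (Hball : Cmod (z + t - z)%C < e) by (rewrite Hdiff; lra).
  specialize (He Hball).
  change (Cmod (F (z + t) - F z - (z + t - z) * l)%C <= m / 3 * Cmod (z + t - z)%C) in He.
  rewrite Hdiff, Hn1 in He.
  (* Both error terms are at most m t / 3, the first because |K| t <= m / 3, so t m <= 2 t m / 3,
     which is absurd. *)
  assert (Hfin : t * m <= K * t ^ 2 + m / 3 * t).
  { replace (t * m) with (Cmod (t * (l - c1))%C)
      by (rewrite Cmod_mult, Hn1; reflexivity).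
    replace (t * (l - c1))%C with ((F (z + t) - F z - t * c1) + - (F (z + t) - F z - t * l))%C
      by ring.
    eapply Rle_trans; [apply Cmod_triangle|]. rewrite Cmod_opp. lra. }
  assert (K * t ^ 2 <= Rabs K * t ^ 2)
    by (apply Rmult_le_compat_r; [apply pow2_ge_0|apply Rle_abs]).
  nra.
Qed.

Lemma le_left_limit (P : R -> R) (c B : R) :
  c < 1 -> continuity_pt P 1 -> (forall x, c < x < 1 -> P x <= B) -> P 1 <= B.
Proof.
  intros Hc HP H. apply le_epsilon. intros eps Heps.
  destruct (HP eps Heps) as (d & Hd & Hlim).
  set (x := 1 - Rmin (d / 2) ((1 - c) / 2)).
  assert (H1 : 0 < Rmin (d / 2) ((1 - c) / 2)) by (apply Rmin_pos; lra).
  pose proof (Rmin_l (d / 2) ((1 - c) / 2)). pose proof (Rmin_r (d / 2) ((1 - c) / 2)).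
  assert (Hx : Rabs (P x - P 1) < eps).
  { apply (Hlim x). split; [split; [exact I|unfold x; lra]|].
    simpl. unfold Rdist, x. rewrite Rabs_left; lra. }
  apply Rabs_def2 in Hx. specialize (H x ltac:(unfold x; lra)). lra.
Qed.

(** On |w| = r the hypothesis gives |N / D| <= 1 / r; the maximum principle carries this inside, and
    r tends to 1. *)
Lemma schwarz_lemma (n d : nat -> C) (N D : C -> C) :
  pseries_on_disc n N -> pseries_on_disc d D ->
  (forall z, Cmod z < 1 -> D z <> 0%C) ->
  (forall z, Cmod z < 1 -> Cmod (z * N z)%C <= Cmod (D z)) ->
  forall z, Cmod z < 1 -> Cmod (N z) <= Cmod (D z).
Proof.
  intros HN HD H0 Hle z Hz.
  (* The factor 1 makes the left side the value at r = 1 of the function passed to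
     [le_left_limit]. *)
  assert (Hq : 1 * Cmod (N z / D z)%C <= 1).
  { apply (le_left_limit (fun r => r * Cmod (N z / D z)%C) (Cmod z)); [exact Hz|reg|].
    intros r Hr. pose proof (Cmod_ge_0 z).
    enough (Cmod (N z / D z)%C <= / r).
    { apply (Rmult_le_reg_l (/ r)); [apply Rinv_0_lt_compat; lra|].
      field_simplify; lra. }
    apply (maximum_modulus (fun w => N w / D w)%C r); try lra.
    - intros w Hw. apply jet2_div; [eapply pseries_on_disc_jet2..|]; eauto; try lra.
      apply H0; lra.
    - intros w Hw. assert (Hw1 : Cmod w < 1) by lra.
      specialize (H0 w Hw1). specialize (Hle w Hw1).
      rewrite Cmod_mult, Hw in Hle. rewrite Cmod_div by exact H0.
      apply Cmod_gt_0 in H0.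
      apply (Rmult_le_reg_r (r * Cmod (D w))); [apply Rmult_lt_0_compat; lra|].
      field_simplify; lra. }
  specialize (H0 z Hz). rewrite Cmod_div in Hq by exact H0. apply Cmod_gt_0 in H0.
  apply (Rmult_le_reg_r (/ Cmod (D z))); [now apply Rinv_0_lt_compat|].
  rewrite Rinv_r by lra. unfold Rdiv in Hq. lra.
Qed.

(* A Schur function presented as a quotient N / D: a Schur step acts linearly on the pair,
   so no series is ever divided. *)
Definition schur_quotient (n d : nat -> C) : Prop :=
  exists N D : C -> C, pseries_on_disc n N /\ pseries_on_disc d D /\
    forall z, Cmod z < 1 -> D z <> 0%C /\ Cmod (N z) <= Cmod (D z).

Lemma schur_quotient_d0 (n d : nat -> C) : schur_quotient n d -> d O <> 0%C.
Proof.
  intros (N & D & HN & HD & H). rewrite <- (pseries_on_disc_0 d D HD).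
  apply H. rewrite Cmod_0. lra.
Qed.

Lemma schur_quotient_scale (n d : nat -> C) (r : R) :
  schur_quotient n d -> 0 <= r <= 1 -> schur_quotient (fun k => r * n k)%C d.
Proof.
  intros (N & D & HN & HD & H) Hr.
  exists (fun z => r * N z + 0 * N z)%C, D. split; [|split; [exact HD|]].
  - intros z Hz. eapply is_pseries_ext; [|exact (pseries_on_disc_lin r 0%C n n N N HN HN z Hz)].
    intros k. change (r * n k + 0 * n k = r * n k)%C. ring.
  - intros z Hz. destruct (H z Hz) as [H1 H2]. split; [exact H1|].
    replace (r * N z + 0 * N z)%C with (r * N z)%C by ring.
    rewrite Cmod_mult, Cmod_R, Rabs_pos_eq by lra.
    pose proof (Cmod_ge_0 (N z)). nra.
Qed.

(** The disc automorphism (q - t) / (1 - conj t q) at q = x / y, cleared of denominators: the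
    difference of the squared moduli is (1 - |t|^2)(|y|^2 - |x|^2). *)
Lemma blaschke_le (x y t : C) :
  Cmod x <= Cmod y -> Cmod t <= 1 -> Cmod (x - t * y)%C <= Cmod (y - Cconj t * x)%C.
Proof.
  intros Hxy Ht. pose proof (Cmod_ge_0 x). pose proof (Cmod_ge_0 t).
  apply Rsqr_incr_0_var; [|apply Cmod_ge_0]. rewrite !Rsqr_pow2.
  enough (Cmod (y - Cconj t * x)%C ^ 2 - Cmod (x - t * y)%C ^ 2
          = (1 - Cmod t ^ 2) * (Cmod y ^ 2 - Cmod x ^ 2)) as E.
  { assert (0 <= (1 - Cmod t ^ 2) * (Cmod y ^ 2 - Cmod x ^ 2)) by (apply Rmult_le_pos; nra). lra. }
  rewrite !Cmod2_alt. destruct x, y, t. simpl. ring.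
Qed.

(** This represents (phi - t0) / (z (1 - conj t0 phi)) for phi = N / D. The numerator N - t0 D
    vanishes at 0, so z divides it; [blaschke_le] bounds the quotient before that division and the
    Schwarz lemma after it. Strictness of |t0| < 1 keeps the new denominator nonzero. *)
Lemma schur_quotient_step (n d : nat -> C) (t0 : C) :
  schur_quotient n d -> n O = (t0 * d O)%C -> Cmod t0 < 1 ->
  schur_quotient (fun k => n (S k) - t0 * d (S k))%C (fun k => d k - Cconj t0 * n k)%C.
Proof.
  intros (N & D & HN & HD & H) Hn0 Ht0.
  assert (HA := pseries_on_disc_lin 1%C (- t0)%C n d N D HN HD).
  assert (HB := pseries_on_disc_lin 1%C (- Cconj t0)%C d n D N HD HN).
  destruct (pseries_on_disc_shift _ _ HA) as (G & HG & HGz).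
  assert (Hn1 : pseries_on_disc (fun k => n (S k) - t0 * d (S k))%C G).
  { intros z Hz. eapply is_pseries_ext; [|exact (HG z Hz)].
    intros k. change (1 * n (S k) + - t0 * d (S k) = n (S k) - t0 * d (S k))%C. ring. }
  set (D1 := fun z => (D z - Cconj t0 * N z)%C).
  assert (Hd1 : pseries_on_disc (fun k => d k - Cconj t0 * n k)%C D1).
  { intros z Hz. replace (D1 z) with (1 * D z + - Cconj t0 * N z)%C by (unfold D1; ring).
    eapply is_pseries_ext; [|exact (HB z Hz)].
    intros k. change (1 * d k + - Cconj t0 * n k = d k - Cconj t0 * n k)%C. ring. }
  assert (HD1 : forall z, Cmod z < 1 -> D1 z <> 0%C).
  { intros z Hz. destruct (H z Hz) as [H1 H2]. apply Cmod_gt_0 in H1. apply Cmod_gt_0.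
    assert (Cmod (D z) <= Cmod (D1 z) + Cmod t0 * Cmod (N z)).
    { rewrite <- (Cmod_conj t0), <- Cmod_mult.
      replace (D z) with (D1 z + Cconj t0 * N z)%C at 1 by (unfold D1; ring).
      apply Cmod_triangle. }
    pose proof (Cmod_ge_0 (N z)). pose proof (Cmod_ge_0 t0). nra. }
  exists G, D1. split; [exact Hn1|]. split; [exact Hd1|]. intros z Hz.
  split; [now apply HD1|]. apply (schwarz_lemma _ _ G D1 Hn1 Hd1 HD1); [|exact Hz].
  clear z Hz. intros z Hz. specialize (HGz z).
  replace (z * G z)%C with (N z - t0 * D z)%C.
  2:{ rewrite Hn0 in HGz.
      replace (z * G z)%C with ((1 * (t0 * d O) + - t0 * d O) + z * G z)%C by ring.
      rewrite <- HGz. ring. }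
  destruct (H z Hz) as [_ H2]. unfold D1.
  apply blaschke_le; lra.
Qed.

Lemma schur_quotient_t0 (n d : nat -> C) (t0 : C) :
  schur_quotient n d -> n O = (t0 * d O)%C -> Cmod t0 <= 1.
Proof.
  intros Hs Hn0. assert (Hd0 := schur_quotient_d0 _ _ Hs).
  destruct Hs as (N & D & HN & HD & H).
  destruct (H 0%C ltac:(rewrite Cmod_0; lra)) as [_ Hle].
  rewrite (pseries_on_disc_0 _ _ HN), (pseries_on_disc_0 _ _ HD), Hn0, Cmod_mult in Hle.
  apply Cmod_gt_0 in Hd0.
  apply (Rmult_le_reg_r (Cmod (d O))); lra.
Qed.

Lemma Cconj_mult_self (t : C) : (Cconj t * t)%C = RtoC (Cmod t ^ 2).
Proof. rewrite Cmod2_conj. ring. Qed.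

(* t0, t1, t2 are the Taylor coefficients at 0 of the quotient, given by n = t * d. *)
Lemma schur_quotient_t1 (n d : nat -> C) (t0 t1 : C) :
  schur_quotient n d -> n O = (t0 * d O)%C -> n 1%nat = (t0 * d 1%nat + t1 * d O)%C ->
  Cmod t1 <= 1 - Cmod t0 ^ 2.
Proof.
  intros Hs Hn0 Hn1. assert (Hd0 := schur_quotient_d0 _ _ Hs).
  assert (Ht0 := schur_quotient_t0 _ _ _ Hs Hn0). pose proof (Cmod_ge_0 t0).
  (* The Schur step needs |t0| < 1. Scaling by r < 1 ensures it and gives r |t1| + r^2 |t0|^2 <= 1,
     whose value at r = 1 is the claim. *)
  enough (1 * Cmod t1 + 1 ^ 2 * Cmod t0 ^ 2 <= 1) by lra.
  apply (le_left_limit (fun r => r * Cmod t1 + r ^ 2 * Cmod t0 ^ 2) 0); [lra|reg|].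
  intros r Hr.
  assert (Hrt : Cmod (r * t0)%C = r * Cmod t0)
    by (rewrite Cmod_mult, Cmod_R, Rabs_pos_eq; lra).
  assert (Hrt1 : Cmod (r * t1)%C = r * Cmod t1)
    by (rewrite Cmod_mult, Cmod_R, Rabs_pos_eq; lra).
  assert (Hlt : Cmod (r * t0)%C < 1) by nra.
  assert (Hsr := schur_quotient_scale n d r Hs ltac:(lra)).
  assert (Hst := schur_quotient_step _ d (r * t0)%C Hsr
                   ltac:(cbv beta; rewrite Hn0; ring) Hlt).
  set (s := 1 - Cmod (r * t0)%C ^ 2).
  assert (Hs0 : 0 < s) by (unfold s; pose proof (Cmod_ge_0 (r * t0)%C); nra).
  assert (Hle := schur_quotient_t0 _ _ (r * t1 / s)%C Hst).
  assert (Hsc : RtoC s <> 0%C) by (intros E; apply RtoC_inj in E; lra).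
  assert (HsE : (Cconj (r * t0) * (r * t0) = 1 - s)%C).
  { rewrite Cconj_mult_self. rewrite <- RtoC_minus. f_equal. unfold s. ring. }
  assert (Heq : (r * n 1%nat - r * t0 * d 1%nat
                 = r * t1 / s * (d O - Cconj (r * t0) * (r * n O)))%C).
  { rewrite Hn1, Hn0.
    replace (Cconj (r * t0) * (r * (t0 * d O)))%C
      with ((Cconj (r * t0) * (r * t0)) * d O)%C by ring.
    rewrite HsE. field. exact Hsc. }
  specialize (Hle Heq). rewrite Cmod_div, Hrt1, Cmod_R, Rabs_pos_eq in Hle by (lra || exact Hsc).
  apply (Rmult_le_compat_r s) in Hle; [|lra].
  unfold Rdiv in Hle. rewrite Rmult_assoc, Rinv_l in Hle by lra.
  unfold s in Hle. rewrite Hrt in Hle. lra.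
Qed.

(** With s = 1 - |t0|^2, the quotient after one Schur step starts with t1 / s and (t2 s + conj t0
    t1^2) / s^2. The first-order bound for these two coefficients, multiplied by s^2, is the
    claim. *)
Lemma schur_quotient_t2 (n d : nat -> C) (t0 t1 t2 : C) :
  schur_quotient n d -> Cmod t0 < 1 ->
  n O = (t0 * d O)%C -> n 1%nat = (t0 * d 1%nat + t1 * d O)%C ->
  n 2%nat = (t0 * d 2%nat + t1 * d 1%nat + t2 * d O)%C ->
  Cmod (t2 * (1 - Cmod t0 ^ 2)%R + Cconj t0 * t1 * t1)%C
    <= (1 - Cmod t0 ^ 2) ^ 2 - Cmod t1 ^ 2.
Proof.
  intros Hs Ht0 Hn0 Hn1 Hn2. pose proof (Cmod_ge_0 t0).
  assert (Hst := schur_quotient_step _ d t0 Hs Hn0 Ht0).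
  assert (HsE : (Cconj t0 * t0 = 1 - (1 - Cmod t0 ^ 2)%R)%C).
  { rewrite Cconj_mult_self, <- RtoC_minus. f_equal. ring. }
  set (s := 1 - Cmod t0 ^ 2) in *.
  assert (Hs0 : 0 < s) by (unfold s; nra).
  assert (Hsc : RtoC s <> 0%C) by (intros E; apply RtoC_inj in E; lra).
  assert (Hle := schur_quotient_t1 _ _ (t1 / s)%C ((t2 * s + Cconj t0 * t1 * t1) / (s * s))%C Hst).
  cbv beta in Hle.
  assert (H0 : (n 1%nat - t0 * d 1%nat = t1 / s * (d O - Cconj t0 * n O))%C).
  { rewrite Hn1, Hn0.
    replace (Cconj t0 * (t0 * d O))%C with ((Cconj t0 * t0) * d O)%C by ring.
    rewrite HsE. field. exact Hsc. }
  assert (H1 : (n 2%nat - t0 * d 2%nat = t1 / s * (d 1%nat - Cconj t0 * n 1%nat)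
     + (t2 * s + Cconj t0 * t1 * t1) / (s * s) * (d O - Cconj t0 * n O))%C).
  { rewrite Hn2, Hn1, Hn0.
    replace (Cconj t0 * (t0 * d O))%C with ((Cconj t0 * t0) * d O)%C by ring.
    replace (Cconj t0 * (t0 * d 1%nat + t1 * d O))%C
      with ((Cconj t0 * t0) * d 1%nat + Cconj t0 * t1 * d O)%C by ring.
    rewrite HsE. field. exact Hsc. }
  specialize (Hle H0 H1).
  assert (Hss : (s * s)%C <> 0%C) by (apply Cmult_neq_0; exact Hsc).
  assert (Hms : Cmod s = s) by (rewrite Cmod_R, Rabs_pos_eq; lra).
  rewrite !Cmod_div, Cmod_mult, Hms in Hle by assumption.
  apply (Rmult_le_compat_r (s * s)) in Hle; [|nra].
  unfold Rdiv in Hle at 1. rewrite Rmult_assoc, Rinv_l, Rmult_1_r in Hle by nra.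
  replace ((1 - (Cmod t1 / s) ^ 2) * (s * s)) with (s ^ 2 - Cmod t1 ^ 2) in Hle by (field; lra).
  exact Hle.
Qed.

(** * The Hankel determinant *)

Definition hankel_form (b : R) (t0 t1 t2 : C) : C :=
  (4 * t0 * t2 + 2 * t0 ^ 2 * t1 - 3 * t1 ^ 2 + (1 - 4 * b ^ 2) * t0 ^ 4)%C.

(** Multiplying by s = 1 - |t0|^2 trades t2 for the quantity [w] that Schur's algorithm controls.
    The triangle inequality then leaves a real inequality in x = |t0| and y = |t1| <= s. *)
Lemma hankel_form_le_strict (b : R) (t0 t1 t2 : C) :
  1 <= b -> Cmod t0 < 1 -> Cmod t1 <= 1 - Cmod t0 ^ 2 ->
  Cmod (t2 * (1 - Cmod t0 ^ 2)%R + Cconj t0 * t1 * t1)%C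
    <= (1 - Cmod t0 ^ 2) ^ 2 - Cmod t1 ^ 2 ->
  Cmod (hankel_form b t0 t1 t2) <= 4 * b ^ 2 - 1.
Proof.
  intros Hb Ht0 Ht1 Ht2. pose proof (Cmod_ge_0 t0) as Hx0. pose proof (Cmod_ge_0 t1) as Hy0.
  assert (HtE : (Cconj t0 * t0 = 1 - (1 - Cmod t0 ^ 2)%R)%C).
  { rewrite Cconj_mult_self, <- RtoC_minus. f_equal. ring. }
  set (w := (t2 * (1 - Cmod t0 ^ 2)%R + Cconj t0 * t1 * t1)%C) in *.
  set (x := Cmod t0) in *. set (y := Cmod t1) in *. set (s := 1 - x ^ 2) in *.
  assert (Hs : 0 < s <= 1) by (unfold s; nra).
  assert (Hms : Cmod s = s) by (rewrite Cmod_R, Rabs_pos_eq; lra).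
  (* Since s t2 = w - conj t0 t1^2 and |t0|^2 = 1 - s, the coefficient of t1^2 becomes -4 (1 - s) -
     3 s = s - 4. *)
  assert (E : (s * hankel_form b t0 t1 t2
    = 4 * t0 * w + (s - 4)%R * t1 ^ 2 + s * (2 * t0 ^ 2 * t1)
      + s * ((1 - 4 * b ^ 2)%R * t0 ^ 4))%C).
  { unfold hankel_form, w.
    rewrite !RtoC_minus, RtoC_mult, <- RtoC_pow. fold s.
    replace (4 * t0 * (t2 * s + Cconj t0 * t1 * t1))%C
      with (4 * t0 * t2 * s + 4 * (Cconj t0 * t0) * t1 * t1)%C by ring.
    rewrite HtE. ring. }
  assert (Hb2 : 1 <= b ^ 2) by nra.
  assert (Hbound : s * Cmod (hankel_form b t0 t1 t2)
    <= 4 * x * (s ^ 2 - y ^ 2) + (4 - s) * y ^ 2 + s * (2 * x ^ 2 * y)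
       + s * ((4 * b ^ 2 - 1) * x ^ 4)).
  { rewrite <- Hms at 1. rewrite <- Cmod_mult, E.
    eapply Rle_trans; [apply Cmod_triangle|]. apply Rplus_le_compat.
    eapply Rle_trans; [apply Cmod_triangle|]. apply Rplus_le_compat.
    eapply Rle_trans; [apply Cmod_triangle|]. apply Rplus_le_compat.
    - rewrite !Cmod_mult, Cmod_R, Rabs_pos_eq by lra. fold x.
      apply Rmult_le_compat_l; [lra|exact Ht2].
    - rewrite Cmod_mult, Cmod_pow, Cmod_R, Rabs_left by lra. fold y. right. ring.
    - rewrite !Cmod_mult, Cmod_pow, Hms, Cmod_R, Rabs_pos_eq by lra. fold x y. lra.
    - rewrite !Cmod_mult, Cmod_pow, Hms, Cmod_R, Rabs_left by lra. fold x. right. ring. }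
  apply (Rmult_le_reg_l s); [lra|].
  (* The weight 4x of s^2 - y^2 is at most the weight 3 + x^2 = 4 - s of y^2, so the worst case is y
     = s. *)
  assert (H1 : 0 <= (3 + x ^ 2 - 4 * x) * (s ^ 2 - y ^ 2)).
  { apply Rmult_le_pos.
    - replace (3 + x ^ 2 - 4 * x) with ((1 - x) * (3 - x)) by ring. apply Rmult_le_pos; lra.
    - replace (s ^ 2 - y ^ 2) with ((s - y) * (s + y)) by ring. apply Rmult_le_pos; lra. }
  assert (H2 : s * (2 * x ^ 2 * y) <= s * (2 * x ^ 2 * s)).
  { apply Rmult_le_compat_l; [lra|]. apply Rmult_le_compat_l; [nra|exact Ht1]. }
  assert (Hx4 : x ^ 4 <= 1) by (replace 1 with (1 ^ 4) by ring; apply pow_incr; lra).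
  assert (H3 : 0 <= s * ((4 * b ^ 2 - 4) * (1 - x ^ 4))).
  { apply Rmult_le_pos; [lra|]. apply Rmult_le_pos; lra. }
  replace (4 - s) with (3 + x ^ 2) in Hbound by (unfold s; ring).
  (* At y = s the first two terms sum to 3 s^2 (1 + x^2) = 3 s (1 - x^4), which combines with the
     x^4 term into a single factor. *)
  assert (H4 : s * (4 * b ^ 2 - 1) - ((3 + x ^ 2) * s ^ 2 + s * (2 * x ^ 2 * s)
      + s * ((4 * b ^ 2 - 1) * x ^ 4)) = s * ((4 * b ^ 2 - 4) * (1 - x ^ 4)))
    by (unfold s; ring).
  nra.
Qed.

Lemma schur_quotient_hankel (n d : nat -> C) (b : R) (t0 t1 t2 : C) :
  1 <= b -> schur_quotient n d ->
  n O = (t0 * d O)%C -> n 1%nat = (t0 * d 1%nat + t1 * d O)%C ->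
  n 2%nat = (t0 * d 2%nat + t1 * d 1%nat + t2 * d O)%C ->
  Cmod (hankel_form b t0 t1 t2) <= 4 * b ^ 2 - 1.
Proof.
  intros Hb Hs Hn0 Hn1 Hn2.
  assert (Ht0 := schur_quotient_t0 _ _ _ Hs Hn0). pose proof (Cmod_ge_0 t0).
  (* [X], [Y], [Z] are the parts of degree 2, 3 and 4 in (t0, t1, t2). Scaling by r multiplies them
     by r^2, r^3, r^4, so the form differs from its scaled version by terms that vanish as r tends
     to 1. *)
  set (X := (4 * t0 * t2 - 3 * t1 ^ 2)%C). set (Y := (2 * t0 ^ 2 * t1)%C).
  set (Z := ((1 - 4 * b ^ 2) * t0 ^ 4)%C).
  set (V := hankel_form b t0 t1 t2).
  enough (1 * Cmod V - (1 - 1 ^ 2) * Cmod X - (1 - 1 ^ 3) * Cmod Y - (1 - 1 ^ 4) * Cmod Z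
          <= 4 * b ^ 2 - 1) by lra.
  apply (le_left_limit (fun r => 1 * Cmod V - (1 - r ^ 2) * Cmod X
    - (1 - r ^ 3) * Cmod Y - (1 - r ^ 4) * Cmod Z) 0); [lra|reg|].
  intros r Hr.
  assert (Hsr := schur_quotient_scale n d r Hs ltac:(lra)).
  assert (Hlt : Cmod (r * t0)%C < 1).
  { rewrite Cmod_mult, Cmod_R, Rabs_pos_eq by lra. nra. }
  assert (Hc0 : (r * n O = r * t0 * d O)%C) by (rewrite Hn0; ring).
  assert (Hc1 : (r * n 1%nat = r * t0 * d 1%nat + r * t1 * d O)%C) by (rewrite Hn1; ring).
  assert (Hc2 : (r * n 2%nat = r * t0 * d 2%nat + r * t1 * d 1%nat + r * t2 * d O)%C)
    by (rewrite Hn2; ring).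
  assert (Hle := hankel_form_le_strict b (r * t0)%C (r * t1)%C (r * t2)%C Hb Hlt
    (schur_quotient_t1 _ _ _ _ Hsr Hc0 Hc1)
    (schur_quotient_t2 _ _ _ _ _ Hsr Hlt Hc0 Hc1 Hc2)).
  assert (HV : V = (hankel_form b (r * t0) (r * t1) (r * t2) + (1 - r ^ 2)%R * X
                    + (1 - r ^ 3)%R * Y + (1 - r ^ 4)%R * Z)%C).
  { unfold V, hankel_form, X, Y, Z. rewrite !RtoC_minus, !RtoC_pow. ring. }
  assert (Hpow : forall k, 0 <= 1 - r ^ k).
  { intros k. assert (r ^ k <= 1 ^ k) by (apply pow_incr; lra). rewrite pow1 in *. lra. }
  assert (Hm : forall k W, Cmod ((1 - r ^ k)%R * W)%C = (1 - r ^ k) * Cmod W).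
  { intros k W. rewrite Cmod_mult, Cmod_R, Rabs_pos_eq; auto. }
  assert (Hfin : Cmod V <= Cmod (hankel_form b (r * t0) (r * t1) (r * t2))
     + (1 - r ^ 2) * Cmod X + (1 - r ^ 3) * Cmod Y + (1 - r ^ 4) * Cmod Z).
  { rewrite HV at 1. rewrite <- !Hm.
    eapply Rle_trans; [apply Cmod_triangle|]. apply Rplus_le_compat_r.
    eapply Rle_trans; [apply Cmod_triangle|]. apply Rplus_le_compat_r, Cmod_triangle. }
  lra.
Qed.

(** The line Re q = -b is the perpendicular bisector of 0 and -2b, so q = A / g on its right is
    nearer to 0 than to -2b. *)
Lemma Cmod_lt_of_Re_div (A g : C) (b : R) :
  0 < b -> g <> 0%C -> - b < Re (A / g)%C -> Cmod A < Cmod (A + 2 * b * g)%C.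
Proof.
  intros Hb Hg HRe. set (q := (A / g)%C) in *.
  replace A with (q * g)%C by (unfold q; field; exact Hg).
  replace (q * g + 2 * b * g)%C with ((q + 2 * b) * g)%C by ring.
  rewrite !Cmod_mult. apply Rmult_lt_compat_r; [now apply Cmod_gt_0|].
  apply Rsqr_incrst_0; [|apply Cmod_ge_0|apply Cmod_ge_0].
  rewrite !Rsqr_pow2, !Cmod2_alt. destruct q as [x y]. simpl in *. nra.
Qed.

(** * From the condition on z f' / f to a Schur quotient and its coefficients *)

Theorem theorem2p1 (alpha : R) (a : nat -> C) (f f' : C -> C) :
  1 <= alpha <= 2 ->
  a 0%nat = 0%C -> a 1%nat = 1%C ->
  (forall z : C, Cmod z < 1 -> is_pseries a z (f z)) ->
  (forall z : C, Cmod z < 1 -> is_derive f z (f' z)) ->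
  (forall z : C, Cmod z < 1 -> z <> 0%C ->
     f z <> 0%C /\ alpha / 2 - 1 < Re (z * f' z / f z)) ->
  Cmod (a 2%nat * a 4%nat - a 3%nat * a 3%nat)%C
    <= (2 - alpha / 2) ^ 2 / 3 * (4 * ((2 - alpha / 2) ^ 2 - 1) + 3).
Proof.
  intros Halpha Ha0 Ha1 Hf Hf' Hre.
  assert (HF : pseries_on_disc a f) by exact Hf.
  set (b := 2 - alpha / 2). assert (Hb : 1 <= b) by (unfold b; lra).
  set (e := fun k => (INR k * a k - a k)%C). set (A := fun z => (z * f' z - f z)%C).
  assert (HA : pseries_on_disc e A).
  { intros z Hz.
    assert (H1 := pseries_on_disc_derive a f z _ HF Hz (Hf' z Hz)).
    assert (H2 := is_pseries_minus (K := C_AbsRing) (V := C_NormedModule) _ _ _ _ _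
      (is_pseries_incr_1 (K := C_AbsRing) (V := C_NormedModule) _ _ _ H1) (Hf z Hz)).
    refine (is_pseries_ext _ _ _ _ _ H2). intros [|k].
    - change (0 + - a O = INR 0 * a O - a O)%C. simpl INR. ring.
    - reflexivity. }
  assert (HB := pseries_on_disc_lin 1%C (2 * b)%C e a A f HA HF).
  (* [A] has vanishing coefficients in degrees 0 and 1, as a 0 = 0 and (1 - 1) a 1 = 0, so z^2
     divides it; A + 2 b f loses a single factor z. *)
  destruct (pseries_on_disc_shift _ _ HA) as (G & HG & HGz).
  destruct (pseries_on_disc_shift _ _ HG) as (N & HN & HNz).
  destruct (pseries_on_disc_shift _ _ HB) as (D & HD & HDz).
  assert (HAN : forall z, A z = (z * (z * N z))%C).
  { intros z. rewrite HGz, HNz. unfold e. rewrite Ha0. simpl INR. ring. }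
  assert (HAD : forall z, (A z + 2 * b * f z)%C = (z * D z)%C).
  { intros z. replace (A z + 2 * b * f z)%C with (1 * A z + 2 * b * f z)%C by ring.
    rewrite HDz. unfold e. rewrite Ha0. ring. }
  (* The hypothesis on z f' / f says nothing at z = 0; there |z N| < |D| holds because D 0 = 2b is
     nonzero. *)
  assert (HD0 : D 0%C = (2 * b)%C).
  { rewrite (pseries_on_disc_0 _ _ HD). unfold e. rewrite Ha1. simpl INR. ring. }
  assert (Hlt : forall z, Cmod z < 1 -> Cmod (z * N z)%C < Cmod (D z)).
  { intros z Hz. destruct (excluded_middle_informative (z = 0%C)) as [->|Hnz].
    - rewrite HD0, Cmult_0_l, Cmod_0, <- RtoC_mult, Cmod_R, Rabs_pos_eq; lra.
    - destruct (Hre z Hz Hnz) as [Hfz Hr].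
      assert (HAlt : Cmod (A z) < Cmod (A z + 2 * b * f z)%C).
      { apply Cmod_lt_of_Re_div; [lra|exact Hfz|].
        replace (A z / f z)%C with (z * f' z / f z - 1)%C by (unfold A; field; exact Hfz).
        change (- b < Re (z * f' z / f z) + - 1). unfold b. lra. }
      rewrite HAD, HAN, Cmod_mult, (Cmod_mult z (D z)) in HAlt.
      apply (Rmult_lt_reg_l (Cmod z)); [now apply Cmod_gt_0|exact HAlt]. }
  assert (HDnz : forall z, Cmod z < 1 -> D z <> 0%C).
  { intros z Hz. apply Cmod_gt_0. eapply Rle_lt_trans; [apply Cmod_ge_0|apply Hlt, Hz]. }
  assert (HS : schur_quotient (fun k => e (S (S k))) (fun k => 1 * e (S k) + 2 * b * a (S k))%C).
  { exists N, D. split; [exact HN|]. split; [exact HD|]. intros z Hz. split; [auto|].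
    apply (schwarz_lemma _ _ N D HN HD HDnz); [|exact Hz].
    intros w Hw. now apply Rlt_le, Hlt. }
  (* Solutions of n = t * d in degrees 0, 1, 2, where [n] starts a2, 2 a3, 3 a4 and [d] starts 2b,
     (1 + 2b) a2, (2 + 2b) a3. *)
  set (t0 := (a 2%nat / (2 * b))%C).
  set (t1 := ((2 * a 3%nat - t0 * (1 + 2 * b) * a 2%nat) / (2 * b))%C).
  set (t2 := ((3 * a 4%nat - t0 * (2 + 2 * b) * a 3%nat - t1 * (1 + 2 * b) * a 2%nat) / (2 * b))%C).
  assert (Hbc : RtoC b <> 0%C) by (intros E; apply RtoC_inj in E; lra).
  assert (H2c : RtoC 2 <> 0%C) by (intros E; apply RtoC_inj in E; lra).
  assert (H3c : RtoC 3 <> 0%C) by (intros E; apply RtoC_inj in E; lra).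
  assert (HV := schur_quotient_hankel _ _ b t0 t1 t2 Hb HS).
  cbv beta in HV. unfold e in HV. rewrite Ha1 in HV.
  replace (INR 4) with 4 in HV by (simpl; ring).
  replace (INR 3) with 3 in HV by (simpl; ring).
  replace (INR 2) with 2 in HV by (simpl; ring).
  replace (INR 1) with 1 in HV by (simpl; ring).
  assert (E0 : (2 * a 2%nat - a 2%nat = t0 * (1 * (1 * 1 - 1) + 2 * b * 1))%C)
    by (unfold t0; field; auto).
  assert (E1 : (3 * a 3%nat - a 3%nat = t0 * (1 * (2 * a 2%nat - a 2%nat) + 2 * b * a 2%nat)
                 + t1 * (1 * (1 * 1 - 1) + 2 * b * 1))%C)
    by (unfold t1; field; auto).
  assert (E2 : (4 * a 4%nat - a 4%nat = t0 * (1 * (3 * a 3%nat - a 3%nat) + 2 * b * a 3%nat)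
                 + t1 * (1 * (2 * a 2%nat - a 2%nat) + 2 * b * a 2%nat)
                 + t2 * (1 * (1 * 1 - 1) + 2 * b * 1))%C)
    by (unfold t2; field; auto).
  specialize (HV E0 E1 E2).
  assert (Hid : (a 2%nat * a 4%nat - a 3%nat * a 3%nat
                 = (b ^ 2 / 3)%R * hankel_form b t0 t1 t2)%C).
  { unfold Rdiv. rewrite RtoC_mult, RtoC_inv, RtoC_pow by lra.
    unfold hankel_form, t2, t1, t0. field. auto. }
  assert (Hb3 : 0 <= b ^ 2 / 3) by nra.
  rewrite Hid, Cmod_mult, Cmod_R, Rabs_pos_eq by exact Hb3.
  apply Rmult_le_compat_l; [exact Hb3|lra].
Qed.
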